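(* $\mathsf{K}_t=\mathsf{Cl2GC{+}FS}=\mathsf{K}\otimes\mathsf{K}{+}\mathsf{BR}$, where the tense operators $F,G,P,H$ are identified with $\Diamond,\Box,\dot{\Diamond},\blacksquare$, respectively; that is, the three logics have the same theorems.
   Context: $\Phi$ is the set of formulas built from a countably infinite set of propositional variables with the connectives $\neg,\vee,\wedge,\to$ and the unary operators $\Diamond,\Box,\dot{\Diamond},\blacksquare$. Axioms are understood as schemes. The Galois connection rules are: from $A\to\blacksquare B$ infer $\Diamond A\to B$; from $\Diamond A\to B$ infer $A\to\blacksquare B$; from $A\to\Box B$ infer $\dot{\Diamond} A\to B$; from $\dot{\Diamond} A\to B$ infer $A\to\Box B$. $\mathsf{Cl2GC{+}FS}$ is the smallest set of formulas of $\Phi$ that contains all instances of classical tautologies and all instances of (FS1) $\Diamond(A\to B)\to(\Box A\to\Diamond B)$ and (FS2) $\dot{\Diamond}(A\to B)\to(\blacksquare A\to\dot{\Diamond} B)$, and is closed under modus ponens and the four Galois connection rules. $\mathsf{K}_t$ is classical (minimal) tense logic; it is obtained from classical propositional logic by adding the four Galois connection rules (i.e. two Galois connections $(\Diamond,\blacksquare)$ and $(\dot{\Diamond},\Box)$) together with the De Morgan axioms $\Box A\leftrightarrow\neg\Diamond\neg A$ and $\blacksquare A\leftrightarrow\neg\dot{\Diamond}\neg A$, with modus ponens. $\mathsf{K}$ with modalities $(\Diamond,\Box)$ is the classical minimal normal modal logic: classical propositional logic, $\Box(A\to B)\to(\Box A\to\Box B)$, $\Diamond A\leftrightarrow\neg\Box\neg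 A$, modus ponens, and necessitation (from $A$ infer $\Box A$). $\mathsf{K}\otimes\mathsf{K}$ is the smallest logic in the language $\Phi$ containing two copies of $\mathsf{K}$, one with $(\Diamond,\Box)$ and one with $(\dot{\Diamond},\blacksquare)$, closed under the rules of both. $\mathsf{K}\otimes\mathsf{K}{+}\mathsf{BR}$ is its smallest extension, closed under the same rules, containing the Brouwerian axioms $A\to\blacksquare\Diamond A$, $\Diamond\blacksquare A\to A$, $A\to\Box\dot{\Diamond} A$, $\dot{\Diamond}\Box A\to A$. *)

(* Defs.v *)
Inductive form : Type :=
| Var (n : nat)
| Neg (A : form)
| Or (A B : form)
| And (A B : form)
| Imp (A B : form)
| Dia (A : form)     (* white diamond, the tense operator F *)
| Box (A : form)     (* white box, the tense operator G *)
| DDia (A : form)    (* dotted diamond, the tense operator P *)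
| BBox (A : form).   (* black box, the tense operator H *)

Definition Iff (A B : form) : form := And (Imp A B) (Imp B A).

(* Purely propositional formulas; tautologies are defined on these, and enter
   the modal logics through arbitrary substitution instances in [form]. *)
Inductive pform : Type :=
| PVar (n : nat)
| PNeg (p : pform)
| POr (p q : pform)
| PAnd (p q : pform)
| PImp (p q : pform).

Fixpoint peval (v : nat -> bool) (p : pform) : bool :=
  match p with
  | PVar n => v n
  | PNeg p => negb (peval v p)
  | POr p q => orb (peval v p) (peval v q)
  | PAnd p q => andb (peval v p) (peval v q)
  | PImp p q => implb (peval v p) (peval v q)
  end.

Definition tautology (p : pform) : Prop := forall v, peval v p = true.

Fixpoint inst (s : nat -> form) (p : pform) : form :=
  match p with
  | PVar n => s n
  | PNeg p => Neg (inst s p)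
  | POr p q => Or (inst s p) (inst s q)
  | PAnd p q => And (inst s p) (inst s q)
  | PImp p q => Imp (inst s p) (inst s q)
  end.

Definition taut_instance (A : form) : Prop :=
  exists (p : pform) (s : nat -> form), tautology p /\ A = inst s p.

(* The smallest set of formulas containing the tautology instances and [Ax],
   closed under modus ponens and the Galois connection rules for the pairs
   (Dia, BBox) and (DDia, Box). *)
Inductive GC_logic (Ax : form -> Prop) : form -> Prop :=
| GC_taut A : taut_instance A -> GC_logic Ax A
| GC_ax A : Ax A -> GC_logic Ax A
| GC_mp A B : GC_logic Ax (Imp A B) -> GC_logic Ax A -> GC_logic Ax B
| GC_Dia_BBox A B : GC_logic Ax (Imp A (BBox B)) -> GC_logic Ax (Imp (Dia A) B)
| GC_BBox_Dia A B : GC_logic Ax (Imp (Dia A) B) -> GC_logic Ax (Imp A (BBox B))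
| GC_DDia_Box A B : GC_logic Ax (Imp A (Box B)) -> GC_logic Ax (Imp (DDia A) B)
| GC_Box_DDia A B : GC_logic Ax (Imp (DDia A) B) -> GC_logic Ax (Imp A (Box B)).

Inductive FS_axiom : form -> Prop :=
| FS1 A B : FS_axiom (Imp (Dia (Imp A B)) (Imp (Box A) (Dia B)))
| FS2 A B : FS_axiom (Imp (DDia (Imp A B)) (Imp (BBox A) (DDia B))).

Definition Cl2GC_FS : form -> Prop := GC_logic FS_axiom.

Inductive DeMorgan_axiom : form -> Prop :=
| DM_Box A : DeMorgan_axiom (Iff (Box A) (Neg (Dia (Neg A))))
| DM_BBox A : DeMorgan_axiom (Iff (BBox A) (Neg (DDia (Neg A)))).

Definition Kt : form -> Prop := GC_logic DeMorgan_axiom.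

Inductive K_axiom (dia box : form -> form) : form -> Prop :=
| K_dist A B : K_axiom dia box (Imp (box (Imp A B)) (Imp (box A) (box B)))
| K_dual A : K_axiom dia box (Iff (dia A) (Neg (box (Neg A)))).

(* In the fusion the boxes pair with the diamonds as (Dia, Box) and
   (DDia, BBox), unlike in the Galois connections.  The axiom schemes range
   over all formulas of the bimodal language. *)
Inductive KK : form -> Prop :=
| KK_taut A : taut_instance A -> KK A
| KK_ax1 A : K_axiom Dia Box A -> KK A
| KK_ax2 A : K_axiom DDia BBox A -> KK A
| KK_mp A B : KK (Imp A B) -> KK A -> KK B
| KK_nec1 A : KK A -> KK (Box A)
| KK_nec2 A : KK A -> KK (BBox A).

Inductive BR_axiom : form -> Prop :=
| BR1 A : BR_axiom (Imp A (BBox (Dia A)))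
| BR2 A : BR_axiom (Imp (Dia (BBox A)) A)
| BR3 A : BR_axiom (Imp A (Box (DDia A)))
| BR4 A : BR_axiom (Imp (DDia (Box A)) A).

Inductive KK_BR : form -> Prop :=
| KKBR_KK A : KK A -> KK_BR A
| KKBR_BR A : BR_axiom A -> KK_BR A
| KKBR_mp A B : KK_BR (Imp A B) -> KK_BR A -> KK_BR B
| KKBR_nec1 A : KK_BR A -> KK_BR (Box A)
| KKBR_nec2 A : KK_BR A -> KK_BR (BBox A).

(* Main.v *)
Require Import Defs.
From Stdlib Require Import List.
Import ListNotations.

(** Each of the three logics is the least set of formulas closed under certain
    rules, so it suffices to close a cycle of inclusions
    [Kt] <= [Cl2GC_FS] <= [KK_BR] <= [Kt], and each inclusion only asks that
    the larger logic satisfy the axioms and rules of the smaller one.  All three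
    are symmetric in [(Dia, Box)] and [(DDia, BBox)], so the derivations are
    carried out for an arbitrary classical set [L] of theorems and arbitrary
    operators [dia], [box], and used once for each pair.

    - De Morgan laws from the Fischer Servi axioms ([box_deMorgan_of_FS]): taking
      the consequent of both FS axioms to be a contradiction turns them into
      incompatibility statements.  One of them is half of the law directly, since
      a left adjoint sends falsum to falsum; the other gives the converse half
      after transposition along the Galois connection.
    - In a normal logic the FS axiom is the contrapositive of distribution
      ([FS_of_normal]), and the Brouwerian axioms are the units and counits of
      the two Galois connections, which together with monotonicity give the
      rules ([galois_of_unit_counit]).
    - A right adjoint preserves truth and conjunction, hence is a normal box
      ([galois_nec], [galois_dist]); the duality [dia A <-> ~ box ~ A] is the
      De Morgan law up to double negation ([dia_dual_of_box_deMorgan]). *)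

(** * Propositional reasoning in an arbitrary classical logic *)

Record classical (L : form -> Prop) : Prop := {
  cl_taut : forall A, taut_instance A -> L A;
  cl_mp : forall A B, L (Imp A B) -> L A -> L B
}.

Ltac mem x l :=
  match l with
  | nil => constr:(false)
  | x :: _ => constr:(true)
  | _ :: ?t => mem x t
  end.

Ltac index x l :=
  match l with
  | x :: _ => constr:(O)
  | _ :: ?t => let n := index x t in constr:(S n)
  end.

Ltac atoms l A :=
  match A with
  | Neg ?B => atoms l B
  | Or ?B ?C => let l' := atoms l B in atoms l' C
  | And ?B ?C => let l' := atoms l B in atoms l' C
  | Imp ?B ?C => let l' := atoms l B in atoms l' C
  | _ => match mem A l with
         | true => l
         | false => constr:(A :: l)
         end
  end.

Ltac skeleton l A :=
  match A with
  | Neg ?B => let p := skeleton l B in constr:(PNeg p)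
  | Or ?B ?C =>
      let p := skeleton l B in let q := skeleton l C in constr:(POr p q)
  | And ?B ?C =>
      let p := skeleton l B in let q := skeleton l C in constr:(PAnd p q)
  | Imp ?B ?C =>
      let p := skeleton l B in let q := skeleton l C in constr:(PImp p q)
  | _ => let n := index A l in constr:(PVar n)
  end.

(** Reads the goal as an instance of a propositional formula whose variables
    number the subformulas not headed by a propositional connective, and checks
    that formula by truth table. *)
Ltac taut :=
  unfold Iff;
  match goal with
  | HL : classical ?L |- ?L ?A =>
      apply (cl_taut L HL);
      let l := atoms (@nil form) A in
      let p := skeleton l A in
      exists p, (fun n => nth n l (Var 0)); split;
      [ let v := fresh "v" in
        intro v; cbn;
        repeat match goal with |- context [v ?n] => destruct (v n) end;
        reflexivity
      | reflexivity ]
  end.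

(** Makes the theorem [H] a premise of the goal, by modus ponens. *)
Ltac use H :=
  match goal with
  | HL : classical ?L |- ?L _ => refine (cl_mp L HL _ _ _ H)
  end.

(** * Galois connections *)

Definition galois (L : form -> Prop) (dia box : form -> form) : Prop :=
  forall A B, L (Imp A (box B)) <-> L (Imp (dia A) B).

Definition monotone (L : form -> Prop) (op : form -> form) : Prop :=
  forall A B, L (Imp A B) -> L (Imp (op A) (op B)).

Lemma galois_unit L dia box (HL : classical L) (HG : galois L dia box) A :
  L (Imp A (box (dia A))).
Proof. apply HG. taut. Qed.

Lemma galois_counit L dia box (HL : classical L) (HG : galois L dia box) A :
  L (Imp (dia (box A)) A).
Proof. apply HG. taut. Qed.

Lemma galois_dia_monotone L dia box :
  classical L -> galois L dia box -> monotone L dia.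
Proof.
  intros HL HG A B H. apply HG.
  use (galois_unit L dia box HL HG B). use H. taut.
Qed.

Lemma galois_of_unit_counit L dia box :
  classical L -> monotone L dia -> monotone L box ->
  (forall A, L (Imp A (box (dia A)))) ->
  (forall A, L (Imp (dia (box A)) A)) ->
  galois L dia box.
Proof.
  intros HL Mdia Mbox Hunit Hcounit A B. split; intro H.
  - use (Mdia _ _ H). use (Hcounit B). taut.
  - use (Mbox _ _ H). use (Hunit A). taut.
Qed.

(** A theorem [A] is implied by everything, in particular by [dia A]; transposing
    [dia A -> A] gives [A -> box A]. *)
Lemma galois_nec L dia box (HL : classical L) (HG : galois L dia box) A :
  L A -> L (box A).
Proof.
  intro H. use H. apply HG. use H. taut.
Qed.

(** Transposed, distribution says that [dia] of the conjunction of the two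
    premises entails [B]; by monotonicity and the counits it entails both
    [A -> B] and [A]. *)
Lemma galois_dist L dia box (HL : classical L) (HG : galois L dia box) A B :
  L (Imp (box (Imp A B)) (Imp (box A) (box B))).
Proof.
  assert (M := galois_dia_monotone L dia box HL HG).
  set (C := And (box (Imp A B)) (box A)).
  assert (H : L (Imp C (box B))).
  { apply HG.
    assert (H1 : L (Imp (dia C) (dia (box (Imp A B))))) by (apply M; unfold C; taut).
    assert (H2 : L (Imp (dia C) (dia (box A)))) by (apply M; unfold C; taut).
    use H1. use H2.
    use (galois_counit L dia box HL HG (Imp A B)).
    use (galois_counit L dia box HL HG A).
    taut. }
  use H. unfold C. taut.
Qed.

(** * Fischer Servi axioms and De Morgan laws *)

Definition FS (L : form -> Prop) (dia box : form -> form) : Prop :=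
  forall A B, L (Imp (dia (Imp A B)) (Imp (box A) (dia B))).

(** Having a right adjoint, [dia] preserves falsum, of which [And C (Neg C)] is
    one formulation; the FS axiom for [Imp A falsum] then becomes an
    incompatibility. *)
Lemma FS_incompatible L dia rad box :
  classical L -> galois L dia rad -> FS L dia box ->
  forall A, L (Imp (dia (Neg A)) (Neg (box A))).
Proof.
  intros HL HG HFS A.
  set (bot := And A (Neg A)).
  assert (Hbot : L (Imp (dia bot) bot)) by (apply HG; unfold bot; taut).
  assert (Hneg : L (Imp (dia (Neg A)) (dia (Imp A bot)))).
  { apply (galois_dia_monotone L dia rad HL HG). unfold bot. taut. }
  use Hbot. use Hneg. use (HFS A bot). unfold bot. taut.
Qed.

(** Both Galois connections are needed.  For the right-to-left half, transpose to
    [dia' (~ dia ~A) -> A]: the FS axiom of the other pair makes the premise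
    incompatible with [box' (dia ~A)], which follows from [~A] by the unit. *)
Lemma box_deMorgan_of_FS L dia box dia' box' :
  classical L -> galois L dia box' -> galois L dia' box ->
  FS L dia box -> FS L dia' box' ->
  forall A, L (Iff (box A) (Neg (dia (Neg A)))).
Proof.
  intros HL HG HG' HFS HFS' A.
  assert (H : L (Imp (Neg (dia (Neg A))) (box A))).
  { apply HG'.
    use (FS_incompatible L dia' box box' HL HG' HFS' (dia (Neg A))).
    use (galois_unit L dia box' HL HG (Neg A)).
    taut. }
  use H. use (FS_incompatible L dia box' box HL HG HFS A). taut.
Qed.

Lemma dia_dual_of_box_deMorgan L dia box :
  classical L -> monotone L dia ->
  (forall A, L (Iff (box A) (Neg (dia (Neg A))))) ->
  forall A, L (Iff (dia A) (Neg (box (Neg A)))).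
Proof.
  intros HL M HDM A.
  assert (H1 : L (Imp (dia A) (dia (Neg (Neg A))))) by (apply M; taut).
  assert (H2 : L (Imp (dia (Neg (Neg A))) (dia A))) by (apply M; taut).
  use H1. use H2. use (HDM (Neg A)). taut.
Qed.

(** * Normal modal logics *)

Record normal (L : form -> Prop) (dia box : form -> form) : Prop := {
  normal_ax : forall A, K_axiom dia box A -> L A;
  normal_nec : forall A, L A -> L (box A)
}.

Lemma normal_box_monotone L dia box :
  classical L -> normal L dia box -> monotone L box.
Proof.
  intros HL HN A B H.
  use (normal_nec _ _ _ HN _ H).
  exact (normal_ax _ _ _ HN _ (K_dist dia box A B)).
Qed.

Lemma normal_dia_monotone L dia box :
  classical L -> normal L dia box -> monotone L dia.
Proof.
  intros HL HN A B H.
  assert (HB : L (Imp (box (Neg B)) (box (Neg A)))).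
  { apply (normal_box_monotone L dia box HL HN). use H. taut. }
  use HB.
  use (normal_ax _ _ _ HN _ (K_dual dia box A)).
  use (normal_ax _ _ _ HN _ (K_dual dia box B)).
  taut.
Qed.

(** By duality and contraposition the axiom says that [box A] and [box ~B] entail
    [box ~(A -> B)], which is distribution applied to the boxed tautology
    [A -> (~B -> ~(A -> B))]. *)
Lemma FS_of_normal L dia box :
  classical L -> normal L dia box -> FS L dia box.
Proof.
  intros HL HN A B.
  assert (H : L (Imp (box A) (box (Imp (Neg B) (Neg (Imp A B)))))).
  { apply (normal_box_monotone L dia box HL HN). taut. }
  use H.
  use (normal_ax _ _ _ HN _ (K_dist dia box (Neg B) (Neg (Imp A B)))).
  use (normal_ax _ _ _ HN _ (K_dual dia box (Imp A B))).
  use (normal_ax _ _ _ HN _ (K_dual dia box B)).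
  taut.
Qed.

Lemma normal_of_galois L dia box dia' box' :
  classical L -> galois L dia box' -> galois L dia' box ->
  (forall A, L (Iff (box A) (Neg (dia (Neg A))))) ->
  normal L dia box.
Proof.
  intros HL HG HG' HDM. split.
  - intros _ [A B | A].
    + exact (galois_dist L dia' box HL HG' A B).
    + apply dia_dual_of_box_deMorgan; auto.
      exact (galois_dia_monotone L dia box' HL HG).
  - exact (galois_nec L dia' box HL HG').
Qed.

(** * The three logics *)

Lemma GC_logic_classical Ax : classical (GC_logic Ax).
Proof. split; [apply GC_taut | apply GC_mp]. Qed.

Lemma GC_logic_galois_Dia Ax : galois (GC_logic Ax) Dia BBox.
Proof. split; [apply GC_Dia_BBox | apply GC_BBox_Dia]. Qed.

Lemma GC_logic_galois_DDia Ax : galois (GC_logic Ax) DDia Box.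
Proof. split; [apply GC_DDia_Box | apply GC_Box_DDia]. Qed.

Lemma GC_logic_least Ax (L : form -> Prop) :
  classical L -> galois L Dia BBox -> galois L DDia Box ->
  (forall A, Ax A -> L A) ->
  forall A, GC_logic Ax A -> L A.
Proof.
  intros HL HG HG' HAx A HA.
  induction HA; try (apply HG; assumption); try (apply HG'; assumption).
  - apply HL; assumption.
  - auto.
  - eapply (cl_mp L HL); eassumption.
Qed.

Lemma KK_BR_classical : classical KK_BR.
Proof.
  split; [intros A H; apply KKBR_KK, KK_taut, H | apply KKBR_mp].
Qed.

Lemma KK_BR_normal_Box : normal KK_BR Dia Box.
Proof.
  split; [intros A H; apply KKBR_KK, KK_ax1, H | apply KKBR_nec1].
Qed.

Lemma KK_BR_normal_BBox : normal KK_BR DDia BBox.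
Proof.
  split; [intros A H; apply KKBR_KK, KK_ax2, H | apply KKBR_nec2].
Qed.

Lemma KK_BR_least (L : form -> Prop) :
  classical L -> normal L Dia Box -> normal L DDia BBox ->
  (forall A, BR_axiom A -> L A) ->
  forall A, KK_BR A -> L A.
Proof.
  intros HL [Hax Hnec] [Hax' Hnec'] HBR.
  assert (HKK : forall A, KK A -> L A).
  { intros A HA. induction HA; auto.
    - apply HL; assumption.
    - eapply (cl_mp L HL); eassumption. }
  intros A HA. induction HA; auto.
  eapply (cl_mp L HL); eassumption.
Qed.

Lemma Kt_sub_Cl2GC_FS A : Kt A -> Cl2GC_FS A.
Proof.
  assert (HL := GC_logic_classical FS_axiom).
  assert (HG := GC_logic_galois_Dia FS_axiom).
  assert (HG' := GC_logic_galois_DDia FS_axiom).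
  assert (HFS : FS Cl2GC_FS Dia Box) by (intros B C; apply GC_ax, FS1).
  assert (HFS' : FS Cl2GC_FS DDia BBox) by (intros B C; apply GC_ax, FS2).
  apply GC_logic_least; auto.
  intros _ [B | B].
  - exact (box_deMorgan_of_FS _ Dia Box DDia BBox HL HG HG' HFS HFS' B).
  - exact (box_deMorgan_of_FS _ DDia BBox Dia Box HL HG' HG HFS' HFS B).
Qed.

Lemma Cl2GC_FS_sub_KK_BR A : Cl2GC_FS A -> KK_BR A.
Proof.
  assert (HL := KK_BR_classical).
  assert (HN := KK_BR_normal_Box).
  assert (HN' := KK_BR_normal_BBox).
  assert (MDia := normal_dia_monotone _ _ _ HL HN).
  assert (MDDia := normal_dia_monotone _ _ _ HL HN').
  assert (MBox := normal_box_monotone _ _ _ HL HN).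
  assert (MBBox := normal_box_monotone _ _ _ HL HN').
  apply GC_logic_least; auto.
  - apply galois_of_unit_counit; auto; intro B; apply KKBR_BR; constructor.
  - apply galois_of_unit_counit; auto; intro B; apply KKBR_BR; constructor.
  - intros _ [B C | B C].
    + exact (FS_of_normal _ _ _ HL HN B C).
    + exact (FS_of_normal _ _ _ HL HN' B C).
Qed.

Lemma KK_BR_sub_Kt A : KK_BR A -> Kt A.
Proof.
  assert (HL := GC_logic_classical DeMorgan_axiom).
  assert (HG := GC_logic_galois_Dia DeMorgan_axiom).
  assert (HG' := GC_logic_galois_DDia DeMorgan_axiom).
  apply KK_BR_least; auto.
  - apply (normal_of_galois _ Dia Box DDia BBox HL HG HG').
    intro B. apply GC_ax, DM_Box.
  - apply (normal_of_galois _ DDia BBox Dia Box HL HG' HG).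
    intro B. apply GC_ax, DM_BBox.
  - intros _ [B | B | B | B].
    + exact (galois_unit _ _ _ HL HG B).
    + exact (galois_counit _ _ _ HL HG B).
    + exact (galois_unit _ _ _ HL HG' B).
    + exact (galois_counit _ _ _ HL HG' B).
Qed.

Theorem corollary2p8 :
  (forall A : form, Kt A <-> Cl2GC_FS A) /\
  (forall A : form, Cl2GC_FS A <-> KK_BR A).
Proof.
  split; intro A; split; intro H.
  - apply Kt_sub_Cl2GC_FS, H.
  - apply KK_BR_sub_Kt, Cl2GC_FS_sub_KK_BR, H.
  - apply Cl2GC_FS_sub_KK_BR, H.
  - apply Kt_sub_Cl2GC_FS, KK_BR_sub_Kt, H.
Qed.
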